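(* Let $\delta\in\{0,1\}$ and $$A=\begin{pmatrix}1 & 0 & \delta\\ 0 & -1 & 0\\ 0 & 0 & -1\end{pmatrix}\in\mathrm{GL}_3(\mathbb{Z}).$$ (1) If $\delta=0$, the group $\mathbb{Z}^3\rtimes_A\mathbb{Z}$ has Reidemeister spectrum $2\mathbb{N}\cup\{\infty\}$. (2) If $\delta=1$, the group $\mathbb{Z}^3\rtimes_A\mathbb{Z}$ has Reidemeister spectrum $4\mathbb{N}\cup\{\infty\}$.
   Context: $\mathbb{N}$ denotes the set of positive integers. For $A\in\mathrm{GL}_n(\mathbb{Z})$, $\mathbb{Z}^n\rtimes_A\mathbb{Z}$ denotes the semidirect product in which a generator of $\mathbb{Z}$ acts on $\mathbb{Z}^n$ by multiplication by $A$. For a group $G$ and an endomorphism $\varphi$ of $G$, say $x\sim_\varphi y$ if there is $z\in G$ with $x=zy\varphi(z)^{-1}$; the Reidemeister number $R(\varphi)$ is the number of equivalence classes of $\sim_\varphi$ ($\infty$ if infinite). The Reidemeister spectrum of $G$ is $\mathrm{Spec}_R(G)=\{R(\varphi)\mid \varphi\in\mathrm{Aut}(G)\}$. *)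

(* Defs.v *)
From HB Require Import structures.
From mathcomp Require Import all_boot all_order all_algebra.
From mathcomp Require Import finmap boolp classical_sets cardinality.

Set Implicit Arguments.
Unset Strict Implicit.
Unset Printing Implicit Defensive.

Import GRing.Theory.
Local Open Scope ring_scope.

Section SemidirectProduct.
Variables (n : nat) (A : 'M[int]_n.+1) (A_unit : A \in unitmx).

(* The proof of invertibility is a parameter of the type so that the group
   structure below can be attached to it by instance inference. *)
Definition semidirect (_ : A \in unitmx) : Type := ('cV[int]_n.+1 * int)%type.
Local Notation G := (semidirect A_unit).

HB.instance Definition _ := Choice.on G.

(* The pair (v, s) stands for v t^s, where t v t^-1 = A v. *)
Definition sd_mul (x y : G) : G := (x.1 + (A ^ x.2) *m y.1, x.2 + y.2).
Definition sd_one : G := (0, 0).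
Definition sd_inv (x : G) : G := (- ((A ^ (- x.2)) *m x.1), - x.2).

Fact sd_mulA : associative sd_mul.
Proof.
move=> [v s] [w t] [u r]; rewrite /sd_mul /=.
by rewrite exprzDr // mulmxDr mulmxA !addrA.
Qed.

Fact sd_mul1 : left_id sd_one sd_mul.
Proof. by move=> [v s]; rewrite /sd_mul /= expr0z mul1mx !add0r. Qed.

Fact sd_mulr1 : right_id sd_one sd_mul.
Proof. by move=> [v s]; rewrite /sd_mul /= mulmx0 !addr0. Qed.

Fact sd_mulV : left_inverse sd_one sd_inv sd_mul.
Proof. by move=> [v s]; rewrite /sd_mul /= !addNr. Qed.

Fact sd_mulrV : right_inverse sd_one sd_inv sd_mul.
Proof.
move=> [v s]; rewrite /sd_mul /= mulmxN mulmxA -[_ *m A ^ _]/(A ^ s * A ^ (- s)).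
by rewrite -exprzDr // !subrr expr0z mul1mx subrr.
Qed.

HB.instance Definition _ :=
  isGroup.Build G sd_mulA sd_mul1 sd_mulr1 sd_mulV sd_mulrV.

End SemidirectProduct.

Section Reidemeister.
Local Open Scope classical_set_scope.
Local Open Scope group_scope.
Variable G : groupType.

Definition twisted_conj (phi : {multiplicative G -> G}) (x y : G) : Prop :=
  exists z : G, x = z * y * (phi z)^-1.

Definition reidemeister_classes (phi : {multiplicative G -> G}) : set (set G) :=
  [set [set x | twisted_conj phi x y] | y in [set: G]].

(* [None] is the value infinity. *)
Definition reidemeister_number (phi : {multiplicative G -> G}) : option nat :=
  if `[< finite_set (reidemeister_classes phi) >]
  then Some #|` fset_set (reidemeister_classes phi)|%fset
  else None.

Definition reidemeister_spectrum : set (option nat) :=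
  [set reidemeister_number phi
     | phi in [set phi : {multiplicative G -> G} | bijective phi]].

End Reidemeister.

(* m N \cup {infinity}, where N is the set of positive integers. *)
Definition multiples_infty (m : nat) : set (option nat) :=
  ([set Some (m * k)%N | k in [set k : nat | (0 < k)%N]] `|` [set None])%classic.

Definition A_delta (delta : int) : 'M[int]_3 :=
  \matrix_(i < 3, j < 3)
    (nth [::] [:: [:: 1; 0; delta];
                  [:: 0; -1; 0];
                  [:: 0; 0; -1]] i)`_j.

Lemma A_delta_unit (delta : int) : A_delta delta \in unitmx.
Proof.
suff E : A_delta delta *m A_delta delta = 1%:M by case: (mulmx1_unit E).
apply/matrixP => i j; rewrite !mxE !big_ord_recl big_ord0 !mxE /=.
by case: i => [[|[|[|i]]] Hi] //; case: j => [[|[|[|j]]] Hj] //=;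
   rewrite ?(mul0r, mulr0, mul1r, mulr1, add0r, addr0, mulrN1, mulN1r, opprK, subrr, oppr0).
Qed.

(* Main.v *)
(* The (-1)-eigenlattice W of A is a copy of Z^2 in G, with G / W = Z^2 acting on
   it through the sign character chi (the parity of the exponent of t).  An
   endomorphism phi preserves W, since the square of w in W is a commutator and
   G / W is torsion-free; so phi induces matrices psi on W and M on G / W.  If
   det (1 - M) <> 0, the twisted classes over a class a of coker (1 - M) are the
   elements of coker (1 - chi(a) psi), and the two signs occur equally often, so
     2 R(phi) = |det (1 - M)| (|det (1 - psi)| + |det (1 + psi)|),
   with R(phi) infinite if one of the determinants vanishes.  Invariance of chi
   makes M 1 0 even, hence tr M and det (1 - M) are even; if delta = 1 the
   relation t e3 t^-1 = A e3 makes psi 0 1, hence tr psi, even as well.  All the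
   multiples are reached with |det (1 - M)| = 2 and det psi = -1. *)
From HB Require Import structures.
Require Import Defs.
From mathcomp Require Import all_boot all_order all_algebra.
From mathcomp Require Import finmap boolp classical_sets cardinality.
From mathcomp Require Import zify ring.

Set Implicit Arguments.
Unset Strict Implicit.
Unset Printing Implicit Defensive.

Import GRing.Theory Num.Theory.
Local Open Scope ring_scope.

(** * Counting the classes of a relation *)

Definition num_classes (T : Type) (E : T -> T -> Prop) (k : nat) : Prop :=
  exists2 f : T -> 'I_k, forall i, exists x, f x = i &
    forall x y, f x = f y <-> E x y.

Definition infinitely_many_classes (T : Type) (E : T -> T -> Prop) : Prop :=
  exists g : nat -> T, forall i j, E (g i) (g j) -> i = j.

Lemma num_classes_fin (T : Type) (E : T -> T -> Prop) (F : finType)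
    (f : T -> F) :
    (forall i, exists x, f x = i) -> (forall x y, f x = f y <-> E x y) ->
  num_classes E #|F|.
Proof.
move=> fsurj fE; exists (enum_rank \o f) => [i | x y /=].
  by have [x fx] := fsurj (enum_val i); exists x; rewrite /= fx enum_valK.
by rewrite -fE; split=> [/enum_rank_inj | ->].
Qed.

(* [j i] parametrises the fibre of [c] over [i], up to [E]. *)
Lemma num_classes_sum (T V : Type) (E : T -> T -> Prop) (I : finType)
    (c : T -> I) (j : I -> V -> T) (D : I -> V -> V -> Prop) (n : I -> nat) :
    (forall x y, E x y -> E y x) ->
    (forall x y z, E x y -> E y z -> E x z) ->
    (forall x y, E x y -> c x = c y) ->
    (forall i v, c (j i v) = i) ->
    (forall x, exists v, E x (j (c x) v)) ->
    (forall i v w, E (j i v) (j i w) <-> D i v w) ->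
    (forall i, num_classes (D i) (n i)) ->
  num_classes E (\sum_i n i).
Proof.
move=> Esym Etr cE cj cov jE Dn; have [r rE] := choice cov.
have Dn' i : {f : V -> 'I_(n i) | (forall a, exists x, f x = a) /\
    forall v w, f v = f w <-> D i v w}.
  by apply: cid; have [f fs fD] := Dn i; exists f.
pose F x : {i : I & 'I_(n i)} := Tagged _ (sval (Dn' (c x)) (r x)).
have -> : (\sum_i n i = #|{: {i : I & 'I_(n i)}}|)%N.
  by rewrite card_tagged sumnE big_map big_enum; apply: eq_bigr => i _; rewrite card_ord.
apply: (@num_classes_fin _ _ _ F) => [[i a] | x y].
  have [fs fD] := svalP (Dn' i); have [v va] := fs a.
  exists (j i v); rewrite /F.
  (* The coordinate chosen for [j i v] need not be [v], but by [jE] the two are [D i]-related and so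
     get the same label. *)
  have := rE (j i v); move: (r _) => w; rewrite cj => /jE/fD vw.
  by rewrite -vw va.
rewrite /F; split=> [Fxy | Exy].
  have cxy : c x = c y by rewrite -[LHS]/(tag (F x)) /F Fxy.
  have := rE x; have := rE y; move: Fxy; move: (r x) (r y) => v w.
  rewrite cxy => /eqP; rewrite eq_Tagged => /eqP/= /(proj2 (svalP (Dn' _))) /jE.
  by move=> vw yw xv; apply: Etr xv (Etr _ _ _ vw (Esym _ _ yw)).
have cxy := cE _ _ Exy.
have := rE x; have := rE y; move: (r x) (r y) => v w.
rewrite cxy => yw xv.
congr Tagged; apply/(proj2 (svalP (Dn' _)))/jE.
exact: Etr (Esym _ _ xv) (Etr _ _ _ Exy yw).
Qed.

(** * Cokernels of integer matrices *)

Definition congr_mod n (N : 'M[int]_n) (v w : 'cV[int]_n) : Prop :=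
  exists u, v - w = N *m u.

Lemma absz_det_unitmx n (M : 'M[int]_n) : M \in unitmx -> `|\det M|%N = 1%N.
Proof. by rewrite unitmxE => /orP[] /eqP ->. Qed.

(** Write [N = L D R] in Smith normal form, with [L] and [R] invertible over the integers. The
    inverse of [L] carries the column lattice of [N] onto that of [D], so the cokernel is a product
    of cyclic groups of orders [|e i|]. *)
Lemma num_classes_congr_mod n (N : 'M[int]_n) :
  \det N != 0 -> num_classes (congr_mod N) `|\det N|.
Proof.
have [L Lu [R Ru [d _ NE]]] := int_Smith_normal_form N.
pose e (i : 'I_n) : int := d`_i.
have dN : `|\det N|%N = (\prod_i `|e i|)%N.
  rewrite NE !det_mulmx !abszM (absz_det_unitmx Lu) (absz_det_unitmx Ru) mul1n muln1.
  rewrite det_trig; last first.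
    by apply/is_trig_mxP => i j ij; rewrite mxE (ltn_eqF ij).
  rewrite (big_morph absz abszM (erefl : `|1|%N = 1%N)).
  by apply: eq_bigr => i _; rewrite mxE eqxx.
move=> N0; have e0 i : e i != 0.
  apply/eqP => ei; move: N0; rewrite -absz_eq0 dN.
  by rewrite (bigD1 i) //= ei.
have lt_mod x i : (`|(x %% e i)%Z| < `|e i|)%N.
  by rewrite -ltz_nat gez0_abs ?modz_ge0 // ltz_mod.
pose F (v : 'cV[int]_n) : {dffun forall i : 'I_n, 'I_`|e i|} :=
  [ffun i => Ordinal (lt_mod ((invmx L *m v) i 0) i)].
have -> : `|\det N|%N = #|{dffun forall i : 'I_n, 'I_`|e i|}|.
  rewrite dN card_dep_ffun foldrE big_map big_enum /=.
  by apply: eq_bigr => i _; rewrite card_ord.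
apply: (@num_classes_fin _ _ _ F) => [a | v w].
  exists (L *m \col_i (a i : nat)%:Z); apply/ffunP => i; apply: val_inj.
  rewrite ffunE /= mulKmx // mxE -modz_abs modz_nat /=.
  by rewrite modn_small.
transitivity (forall i, (e i %| ((invmx L *m (v - w)) i 0)%R)%Z).
  split=> [/ffunP Fvw i | dv].
    have /(congr1 val) := Fvw i; rewrite !ffunE /= => vw.
    rewrite mulmxBr !mxE -eqz_mod_dvd.
    move: vw; rewrite !mxE => vw; apply/eqP.
    by rewrite -[LHS]gez0_abs ?modz_ge0 // vw gez0_abs ?modz_ge0.
  apply/ffunP => i; rewrite !ffunE; apply: val_inj => /=.
  have := dv i; rewrite mulmxBr.
  by rewrite [X in (_ %| X)%Z]mxE [X in _ + X]mxE -eqz_mod_dvd => /eqP ->.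
split=> [dv | [u vw] i].
  have /= [q qE] := choice (fun i => elimT dvdzP (dv i)).
  exists (invmx R *m \col_i q i).
  rewrite NE -!mulmxA mulKVmx //; apply: (canRL (mulKVmx Lu)).
  apply/colP => i; rewrite qE !mxE (bigD1 i) //= !mxE eqxx mulrC big1 ?addr0 //.
  by move=> k ki; rewrite mxE eq_sym val_eqE (negPf ki) mul0r.
rewrite vw NE -!mulmxA mulKmx // mxE (bigD1 i) //= mxE eqxx big1 ?addr0 ?dvdz_mulr //.
by move=> k ki; rewrite mxE eq_sym val_eqE (negPf ki) mul0r.
Qed.

(** A nonzero row [r] with [r N = 0] is a linear form constant on classes. It separates the
    multiples of a basis vector at which it does not vanish. *)
Lemma congr_mod_singular n (N : 'M[int]_n) :
  \det N = 0 -> infinitely_many_classes (congr_mod N).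
Proof.
move=> /eqP/det0P[r r0 rN].
have [i ri] : exists i, r 0 i != 0 by apply/rV0Pn.
exists (fun k => k%:Z *: delta_mx i 0) => k l [u kl].
have : r *m (k%:Z *: delta_mx i 0 - l%:Z *: delta_mx i 0) = 0 :> 'cV_1.
  by rewrite kl mulmxA rN mul0mx.
rewrite -scalerBl -scalemxAr -colE => /colP/(_ 0); rewrite !mxE => /eqP.
by rewrite mulf_eq0 (negPf ri) orbF subr_eq0 => /eqP[].
Qed.

(** * Twisted conjugacy classes and the Reidemeister number *)

Section Multiplicative.
Variables (G H : groupType) (f : {multiplicative G -> H}).

Lemma multiplicative1 : f 1%g = 1%g.
Proof. by apply: (mulgI (f 1%g)); rewrite -gmulfM !mulg1. Qed.

Lemma multiplicativeV x : f x^-1%g = (f x)^-1%g.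
Proof.
by apply: (mulgI (f x)); rewrite -gmulfM !mulgV multiplicative1.
Qed.

End Multiplicative.

Section ReidemeisterNumber.
Variables (G : groupType) (phi : {multiplicative G -> G}).

Lemma twisted_conj_refl x : twisted_conj phi x x.
Proof. by exists 1%g; rewrite multiplicative1 invg1 mulg1 mul1g. Qed.

Lemma twisted_conj_sym x y : twisted_conj phi x y -> twisted_conj phi y x.
Proof.
by move=> [z ->]; exists z^-1%g; rewrite multiplicativeV invgK -!mulgA mulVg mulg1 mulKg.
Qed.

Lemma twisted_conj_trans x y z :
  twisted_conj phi x y -> twisted_conj phi y z -> twisted_conj phi x z.
Proof.
by move=> [s ->] [t ->]; exists (s * t)%g; rewrite gmulfM invgM !mulgA.
Qed.

Lemma twisted_conj_classE x y :
  [set s | twisted_conj phi s x]%classic = [set s | twisted_conj phi s y]%classic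
    <-> twisted_conj phi x y.
Proof.
split=> [/seteqP[/(_ x) + _] | xy]; first by apply; apply: twisted_conj_refl.
apply/seteqP; split=> s /= sE; first exact: twisted_conj_trans sE xy.
exact: twisted_conj_trans sE (twisted_conj_sym xy).
Qed.

Lemma reidemeister_number_finite k :
  num_classes (twisted_conj phi) k -> reidemeister_number phi = Some k.
Proof.
move=> [f fsurj fE].
pose h (i : nat) := [set x | f x = i :> nat]%classic.
have clE : (reidemeister_classes phi = h @` `I_k)%classic.
  apply/seteqP; split=> [_ [y _ <-] | _ [i /= ik <-]].
    exists (f y); first exact: ltn_ord.
    apply/seteqP; split=> x /= xy; first exact/fE/val_inj.
    by congr (val _); apply/fE.
  have [y fy] := fsurj (Ordinal ik).
  exists y => //; apply/seteqP; split=> x; rewrite /h /=; last first.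
    by move=> fx; apply/fE/val_inj; rewrite /= fx fy.
  by move=> /fE; rewrite fy => ->.
have card_cl : (reidemeister_classes phi #= `I_k)%card.
  (* [h] is injective below [k] because every fibre of [f] is nonempty. *)
  rewrite clE; apply: inj_card_eq; move=> i j; rewrite inE /= => ik _ hij.
  have [y fy] := fsurj (Ordinal ik).
  have : h i y by rewrite /h /= fy.
  by rewrite hij /h /= fy.
rewrite /reidemeister_number asboolT ?(card_fset_set card_cl) //.
by rewrite clE; apply/finite_image/finite_II.
Qed.

Lemma reidemeister_number_infinite :
  infinitely_many_classes (twisted_conj phi) -> reidemeister_number phi = None.
Proof.
move=> [g gE]; rewrite /reidemeister_number asboolF // => fin.
pose h i := [set x | twisted_conj phi x (g i)]%classic.
(* [h] is injective, so finitely many classes would have a finite preimage, which is all of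
   [nat]. *)
apply: infinite_nat; rewrite (_ : setT = (h @^-1` reidemeister_classes phi)%classic).
  by apply: finite_preimage fin => i j _ _ /twisted_conj_classE/gE.
by apply/seteqP; split=> // i _; exists (g i).
Qed.

End ReidemeisterNumber.

(** * Endomorphisms of extensions with a sign action *)

Lemma mulmx_det_inj n (N : 'M[int]_n) (u : 'cV[int]_n) :
  \det N != 0 -> N *m u = 0 -> u = 0.
Proof.
move=> N0 Nu; apply/eqP; have := congr1 (mulmx (\adj N)) Nu.
rewrite mulmx0 mulmxA mul_adj_mx mul_scalar_mx => /eqP.
by rewrite scalemx_eq0 (negPf N0).
Qed.

Lemma additive_mulmx n m (f : 'cV[int]_n -> 'cV[int]_m) :
  {morph f : v w / v + w} -> exists N : 'M[int]_(m, n), forall v, f v = N *m v.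
Proof.
move=> fD.
have f0 : f 0 = 0 by apply: (addIr (f 0)); rewrite -fD !add0r.
have fN v : f (- v) = - f v by apply: (addIr (f v)); rewrite -fD !addNr.
have fZn (k : nat) v : f (k%:Z *: v) = k%:Z *: f v.
  elim: k => [|k IH]; first by rewrite !scale0r.
  by rewrite intS !scalerDl fD !scale1r IH.
have fZ (k : int) v : f (k *: v) = k *: f v.
  by case: (intP k) => [|a|a]; rewrite ?fZn // ?scale0r // !scaleNr fN fZn.
exists (\matrix_(i, j) f (delta_mx j 0) i 0) => v.
rewrite [v in LHS](_ : v = \sum_j v j 0 *: delta_mx j 0); last first.
  by rewrite [LHS]matrix_sum_delta; apply: eq_bigr => i _; rewrite big_ord1.
rewrite (big_morph f fD f0); apply/colP => i; rewrite summxE mxE.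
by apply: eq_bigr => j _; rewrite fZ !mxE mulrC.
Qed.

(* [G] is an extension of [Z^m] by [Z^n] on which [Z^m] acts through a
   nontrivial sign character [chi]. *)
Record sign_extension (G : groupType) (n m : nat) (iota : 'cV[int]_n -> G)
    (p : G -> 'cV[int]_m) (chi : 'cV[int]_m -> int) : Prop := SignExtension {
  iotaD : {morph iota : v w / v + w >-> (v * w)%g};
  iota_inj : injective iota;
  projM : {morph p : x y / (x * y)%g >-> x + y};
  proj_surj : forall a, exists x, p x = a;
  proj_ker : forall x, p x = 0 <-> exists w, x = iota w;
  chiD : {morph chi : a b / a + b >-> a * b};
  chi_sign : forall a, chi a = 1 \/ chi a = -1;
  chi_nontrivial : exists a, chi a = -1;
  iota_conj : forall x w, (x * iota w)%g = (iota (chi (p x) *: w) * x)%g }.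

Section SignExtensionTheory.
Variables (G : groupType) (n m : nat) (iota : 'cV[int]_n -> G)
  (p : G -> 'cV[int]_m) (chi : 'cV[int]_m -> int).
Hypothesis ext : sign_extension iota p chi.

Lemma iota0 : iota 0 = 1%g.
Proof. by apply: (mulgI (iota 0)); rewrite -(iotaD ext) addr0 mulg1. Qed.

Lemma iotaN w : iota (- w) = (iota w)^-1%g.
Proof. by apply: (mulgI (iota w)); rewrite -(iotaD ext) subrr mulgV iota0. Qed.

Lemma proj_iota w : p (iota w) = 0.
Proof. by apply/(proj_ker ext); exists w. Qed.

Lemma projV x : p x^-1%g = - p x.
Proof.
by apply: (addrI (p x)); rewrite -(projM ext) mulgV subrr -iota0 proj_iota.
Qed.

Lemma proj_eq x y : p x = p y -> exists w, x = (iota w * y)%g.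
Proof.
move=> xy; have /(proj_ker ext)[w xyw] : p (x * y^-1)%g = 0.
  by rewrite (projM ext) projV xy subrr.
by exists w; rewrite -xyw mulgVK.
Qed.

Lemma chi_sqr a : chi a * chi a = 1.
Proof. by case: (chi_sign ext a) => ->. Qed.

Section Endomorphism.
Variable phi : {multiplicative G -> G}.

(* [iota w] has square [[iota (- w), x]] for any [x] acting by [-1], and the
   target of [p] is abelian and torsion-free. *)
Lemma proj_phi_iota w : p (phi (iota w)) = 0.
Proof.
have [a a1] := chi_nontrivial ext; have [x xa] := proj_surj ext a.
have := congr1 (p \o phi) (iota_conj ext x w).
rewrite /= xa a1 scaleN1r iotaN !gmulfM !(projM ext) multiplicativeV projV.
rewrite addrC => /addIr; set v := p _ => vN.
apply/colP => i; have := congr1 (fun u : 'cV_m => u i 0) vN.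
by rewrite !mxE => /eqP; rewrite -addr_eq0 -mulr2n mulrn_eq0 => /eqP.
Qed.

Lemma endo_matrices :
  exists (psi : 'M[int]_n) (M : 'M[int]_m),
    (forall w, phi (iota w) = iota (psi *m w)) /\
    (forall x, p (phi x) = M *m p x).
Proof.
have [f fE] := choice (fun w => iffLR (proj_ker ext _) (proj_phi_iota w)).
have [w w'|psi psiE] := @additive_mulmx n n f.
  by apply: (iota_inj ext); rewrite -fE !(iotaD ext) gmulfM !fE.
have [s sE] := choice (proj_surj ext).
(* Since [phi] sends the kernel of [p] into itself, the matrix [M] read off from the section [s]
   describes [phi] on every lift. *)
have pE x y : p x = p y -> p (phi x) = p (phi y).
  by move=> /proj_eq[w ->]; rewrite gmulfM (projM ext) proj_phi_iota add0r.
have [a b|M ME] := @additive_mulmx m m (fun a => p (phi (s a))).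
  rewrite -(projM ext) -gmulfM; apply: pE.
  by rewrite (projM ext) !sE.
exists psi, M; split=> [w | x]; first by rewrite fE psiE.
by rewrite -ME; apply: pE; rewrite sE.
Qed.

Variables (psi : 'M[int]_n) (M : 'M[int]_m).
Hypothesis psiE : forall w, phi (iota w) = iota (psi *m w).
Hypothesis ME : forall x, p (phi x) = M *m p x.

(** Applying [phi] to the conjugation rule for a basis vector [w] gives
    [chi (M a) psi w = chi a psi w], and [psi w] is nonzero because [psi] is injective. *)
Lemma chi_endo : (0 < n)%N -> \det psi != 0 -> forall a, chi (M *m a) = chi a.
Proof.
move=> n_gt0 dpsi a.
have [x xa] := proj_surj ext a.
pose w : 'cV[int]_n := delta_mx (Ordinal n_gt0) 0.
have := congr1 phi (iota_conj ext x w).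
rewrite !gmulfM !psiE (iota_conj ext) ME xa => /mulIg/(iota_inj ext)/eqP.
rewrite -scalemxAr -subr_eq0 -scalerBl scalemx_eq0 subr_eq0 => /orP[/eqP// |].
move=> /eqP/(mulmx_det_inj dpsi)/matrixP/(_ (Ordinal n_gt0) 0).
by rewrite !mxE !eqxx.
Qed.

Hypothesis chiM : forall a, chi (M *m a) = chi a.

Lemma twisted_conj_proj x y :
  twisted_conj phi x y -> congr_mod (1%:M - M) (p x) (p y).
Proof.
move=> [z ->]; exists (p z); rewrite !(projM ext) projV ME mulmxBl mul1mx.
by rewrite addrAC addrK.
Qed.

(** By invariance under [M], the character [chi] takes equal values at [u] and [M u], hence is 1 on
    the image of [1 - M]. *)
Lemma chi_congr_mod a b : congr_mod (1%:M - M) a b -> chi a = chi b.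
Proof.
move=> [u ab]; have -> : a = b + (u - M *m u).
  by rewrite -[u in u - _]mul1mx -mulmxBl -ab addrC subrK.
have := chiD ext (u - M *m u) (M *m u); rewrite subrK chiM => uu.
rewrite (chiD ext) (_ : chi (u - M *m u) = 1) ?mulr1 //.
by have := chi_sqr u; move: uu; case: (chi_sign ext u) => ->; lia.
Qed.

(** An element [z] relating two points over the same [a] has [p z] fixed by [M], so [p z = 0] and
    [z = iota u]. Twisting by [iota u] translates the fibre coordinate by [(1 - chi a psi) u]. *)
Lemma twisted_conj_fiber s a v w :
    p s = a -> \det (1%:M - M) != 0 ->
  twisted_conj phi (iota v * s)%g (iota w * s)%g
    <-> congr_mod (1%:M - chi a *: psi) v w.
Proof.
move=> sa detM; have conj_s u : (s * iota u = iota (chi a *: u) * s)%g.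
  by rewrite (iota_conj ext) sa.
have tE u : (iota u * (iota w * s) * (phi (iota u))^-1 =
    iota (w + (1%:M - chi a *: psi) *m u) * s)%g.
  rewrite psiE -iotaN -!mulgA conj_s !mulgA -!(iotaD ext).
  by rewrite mulmxBl mul1mx scalerN scalemxAl addrA [u + w]addrC.
split=> [vw | [u vw]]; last first.
  by exists (iota u); rewrite tE -vw addrC subrK.
have [z zE] := vw; have /(proj_ker ext)[u uE] : p z = 0.
  apply: (mulmx_det_inj detM); have := congr1 p zE.
  rewrite !(projM ext) !proj_iota !add0r projV ME sa => zE'.
  by rewrite mulmxBl mul1mx; apply: (addIr a); rewrite add0r {2}zE' addrAC.
exists u; apply: (addrI w); rewrite addrC subrK; apply: (iota_inj ext).
by apply: (mulIg s); rewrite zE uE tE.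
Qed.

Lemma reidemeister_number_extension :
    \det (1%:M - M) != 0 -> \det (1%:M - psi) != 0 ->
    \det (1%:M + psi) != 0 ->
  exists2 k, reidemeister_number phi = Some k &
    (2 * k = `|\det (1%:M - M)| *
      (`|\det (1%:M - psi)| + `|\det (1%:M + psi)|))%N.
Proof.
move=> detM det1 det2.
have [f fsurj fE] := num_classes_congr_mod detM.
have [r rE] := choice fsurj.
have [s sE] := choice (proj_surj ext).
pose h (x : int) := `|\det (1%:M - x *: psi)|%N.
have E1 : 1%:M - 1 *: psi = 1%:M - psi by rewrite scale1r.
have E2 : 1%:M - (-1) *: psi = 1%:M + psi by rewrite scaleN1r opprK.
have cl : num_classes (twisted_conj phi) (\sum_i h (chi (r i)))%N.
  apply: (@num_classes_sum _ 'cV[int]_n _ _ (fun x => f (p x))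
    (fun i v => iota v * s (r i))%g
    (fun i => congr_mod (1%:M - chi (r i) *: psi))).
  - exact: twisted_conj_sym.
  - exact: twisted_conj_trans.
  - by move=> x y /twisted_conj_proj/fE.
  - by move=> i v; rewrite (projM ext) proj_iota add0r sE rE.
  - move=> x; have /fE[b bE] : f (p x) = f (r (f (p x))) by rewrite rE.
    set a := r _ in bE *.
    (* As [p x = a + (1 - M) b], twisting [x] by the inverse of a lift of [b] moves it into the
       fibre over [a]. *)
    have [v vE] : exists v, ((s b)^-1 * x * phi (s b) = iota v * s a)%g.
      apply: proj_eq; rewrite !(projM ext) projV ME !sE.
      move: bE; rewrite mulmxBl mul1mx => /(canRL (subrK _)) ->.
      by rewrite -!addrA addKr [a + _]addrC addKr.
    by exists v; exists (s b); rewrite -vE !mulgA mulgV mul1g mulgK.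
  - by move=> i v w; apply: twisted_conj_fiber.
  - move=> i; apply: num_classes_congr_mod.
    by case: (chi_sign ext (r i)) => ->; rewrite ?E1 ?E2.
exists (\sum_i h (chi (r i)))%N; first exact: reidemeister_number_finite.
have [a a1] := chi_nontrivial ext.
(* Translation by [a] permutes the cokernel of [1 - M] and flips [chi]. Reindexing one of two copies
   of the sum by it pairs each [h 1] with an [h (-1)]. *)
pose t i := f (r i + a).
have t_inj : injective t.
  move=> i j /fE[u]; rewrite [r j + a]addrC addrKA => ij; rewrite -(rE i) -(rE j).
  by apply/fE; exists u.
have chit i : chi (r (t i)) = - chi (r i).
  rewrite (@chi_congr_mod _ (r i + a)); last by apply/fE; rewrite rE.
  by rewrite (chiD ext) a1 mulrN1.
rewrite mul2n -addnn {2}(reindex_inj t_inj) -big_split /=.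
rewrite (eq_bigr (fun=> (h 1%R + h (-1)%R)%N)) => [|i _].
  by rewrite sum_nat_const card_ord /h E1 E2.
by rewrite chit; case: (chi_sign ext (r i)) => ->; rewrite ?opprK // addnC.
Qed.

Lemma reidemeister_number_extension_singular :
    \det (1%:M - M) = 0 \/ \det (1%:M - psi) = 0 \/ \det (1%:M + psi) = 0 ->
  reidemeister_number phi = None.
Proof.
move=> det0; apply: reidemeister_number_infinite.
have [s sE] := choice (proj_surj ext).
have [dM | dM] := eqVneq (\det (1%:M - M)) 0.
  have [g gE] := congr_mod_singular dM; exists (s \o g) => i j /= /twisted_conj_proj.
  by rewrite !sE => /gE.
(* The quotient is now nonsingular, so it is enough to find one fibre with infinitely many classes;
   both signs occur, at [a] and at [a + a]. *)
suff [a] : exists a, \det (1%:M - chi a *: psi) = 0.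
  move=> /congr_mod_singular[g gE]; exists (fun i => iota (g i) * s a)%g => i j.
  by move=> /(twisted_conj_fiber _ _ (sE a) dM)/gE.
case: det0 => [/eqP|]; first by rewrite (negPf dM).
have [a a1] := chi_nontrivial ext.
case=> d; last by exists a; rewrite a1 scaleN1r opprK.
by exists (a + a); rewrite (chiD ext) a1 mulN1r opprK scale1r.
Qed.

End Endomorphism.
End SignExtensionTheory.

Lemma mulmx_ext n m (N N' : 'M[int]_(m, n)) :
  (forall w : 'cV_n, N *m w = N' *m w) -> N = N'.
Proof.
move=> e; apply/matrixP => i j.
by have /colP/(_ i) := e (delta_mx j 0); rewrite -!colE !mxE.
Qed.

(** The matrices attached to the inverse automorphism are the inverse matrices. *)
Lemma endo_matrices_unitmx (G : groupType) (n m : nat)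
    (iota : 'cV[int]_n -> G) (p : G -> 'cV[int]_m) (chi : 'cV[int]_m -> int)
    (phi : {multiplicative G -> G}) (psi : 'M[int]_n) (M : 'M[int]_m) :
    sign_extension iota p chi -> bijective phi ->
    (forall w, phi (iota w) = iota (psi *m w)) ->
    (forall x, p (phi x) = M *m p x) ->
  psi \in unitmx /\ M \in unitmx.
Proof.
move=> ext [f phiK fK] psiE ME.
have fM : {morph f : x y / (x * y)%g} := can2_gmulfM phiK fK.
pose phi' : {multiplicative G -> G} := HB.pack f (isMultiplicative.Build G G f fM).
have [psi' [M' [psiE' ME']]] := endo_matrices ext phi'.
split.
  suff /mulmx1_unit[] : psi *m psi' = 1%:M by [].
  apply: mulmx_ext => w; apply: (iota_inj ext).
  by rewrite -mulmxA -psiE -psiE' mul1mx fK.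
suff /mulmx1_unit[] : M *m M' = 1%:M by [].
apply: mulmx_ext => a; have [x <-] := proj_surj ext a.
by rewrite -mulmxA -ME' -ME mul1mx fK.
Qed.

(** * The group in coordinates, as a sign extension *)

Definition col2 (a b : int) : 'cV[int]_2 := \col_(i < 2) [:: a; b]`_i.

Lemma col2P (w : 'cV[int]_2) : w = col2 (w 0 0) (w 1 0).
Proof.
by apply/colP => i; rewrite mxE; case: i => [[|[|]]] //= ?; congr (w _ _); apply: val_inj.
Qed.

Lemma col2_inj a b a' b' : col2 a b = col2 a' b' -> a = a' /\ b = b'.
Proof. by move=> /colP e; move: (e 0) (e 1); rewrite !mxE. Qed.

Lemma col2D a b a' b' : col2 a b + col2 a' b' = col2 (a + a') (b + b').
Proof. by apply/colP => i; rewrite !mxE; case: i => [[|[|]]] //= ?. Qed.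

Lemma col2Z k a b : k *: col2 a b = col2 (k * a) (k * b).
Proof. by apply/colP => i; rewrite !mxE; case: i => [[|[|]]] //= ?. Qed.

Lemma mulmx_col2 (N : 'M[int]_2) a b :
  N *m col2 a b = col2 (N 0 0 * a + N 0 1 * b) (N 1 0 * a + N 1 1 * b).
Proof.
apply/colP => i; rewrite !mxE !big_ord_recl big_ord0 !mxE /= addr0.
by case: i => [[|[|]]] //= ?; congr (N _ _ * _ + N _ _ * _); apply: val_inj.
Qed.

Definition mx22 (a b c d : int) : 'M[int]_2 :=
  \matrix_(i < 2, j < 2) (nth [::] [:: [:: a; b]; [:: c; d]] i)`_j.

Lemma parity (s : int) : (s %% 2)%Z = 0 \/ (s %% 2)%Z = 1.
Proof. lia. Qed.

Section ADelta.
Variable delta : int.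
Hypothesis delta01 : delta = 0 \/ delta = 1.
Notation G := (semidirect (A_delta_unit delta)).

Definition elt (a b c s : int) : G := (\col_(i < 3) [:: a; b; c]`_i, s).

Lemma eltP (x : G) : exists a b c s, x = elt a b c s.
Proof.
exists (x.1 0 0), (x.1 1 0), (x.1 2%:R 0), x.2.
case: x => v s; congr pair; apply/colP => i; rewrite !mxE /=.
by case: i => [[|[|[|]]]] //= ?; congr (v _ _); apply: val_inj.
Qed.

Lemma elt_inj a b c s a' b' c' s' :
  elt a b c s = elt a' b' c' s' -> [/\ a = a', b = b', c = c' & s = s'].
Proof.
move=> [/colP e ->]; move: (e 0) (e 1) (e 2%:R); rewrite !mxE /=.
by move=> -> -> ->.
Qed.

Lemma A_delta_exprz (s : int) :
  A_delta delta ^ s = if (s %% 2)%Z == 0 then 1%:M else A_delta delta.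
Proof.
have A2 : A_delta delta * A_delta delta = 1.
  apply/matrixP => i j; rewrite !mxE !big_ord_recl big_ord0 !mxE /=.
  by case: i => [[|[|[|i]]] Hi] //; case: j => [[|[|[|j]]] Hj] //=; ring.
have Au : A_delta delta \is a GRing.unit by apply: A_delta_unit.
rewrite {1}(divz_eq s 2) exprzDr // mulrC -exprz_exp -[_ ^ 2]/(_ * _) A2 exp1rz mul1r.
by case: (parity s) => ->.
Qed.

(** [A] is an involution, so its power depends only on the parity of [s]; [1 - 2 * (s %% 2)] is the
    sign of [s]. *)
Lemma eltM a b c s a' b' c' s' :
  (elt a b c s * elt a' b' c' s')%g =
  elt (a + a' + delta * (s %% 2)%Z * c') (b + (1 - 2 * (s %% 2)%Z) * b')
    (c + (1 - 2 * (s %% 2)%Z) * c') (s + s').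
Proof.
rewrite -[LHS]/(sd_mul _ _) /sd_mul /=; congr pair; rewrite A_delta_exprz.
by apply/colP => i; case: (parity s) => ->; rewrite /= ?mul1mx !mxE
  ?big_ord_recl ?big_ord0 ?mxE /=; case: i => [[|[|[|]]]] //= ?; ring.
Qed.

(* [iotaG] parametrises [{v | A v = - v}], with basis [e2, e3] if [delta = 0] and
   [e2, e1 - 2 e3] if [delta = 1]; [projG] is the projection modulo it. *)
Definition iotaG (w : 'cV[int]_2) : G :=
  elt (delta * w 1 0) (w 0 0) ((1 - 3 * delta) * w 1 0) 0.

Definition projG (x : G) : 'cV[int]_2 :=
  col2 ((1 + delta) * x.1 0 0 + delta * x.1 2%:R 0) x.2.

Definition chiG (a : 'cV[int]_2) : int := 1 - 2 * ((a 1 0)%R %% 2)%Z.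

Lemma iotaG_col2 a b : iotaG (col2 a b) = elt (delta * b) a ((1 - 3 * delta) * b) 0.
Proof. by rewrite /iotaG !mxE. Qed.

Lemma projG_elt a b c s : projG (elt a b c s) = col2 ((1 + delta) * a + delta * c) s.
Proof. by rewrite /projG !mxE. Qed.

Lemma chiG_col2 a b : chiG (col2 a b) = 1 - 2 * (b %% 2)%Z.
Proof. by rewrite /chiG !mxE. Qed.

Lemma sign_extensionG : sign_extension iotaG projG chiG.
Proof.
split.
- move=> v w; rewrite (col2P v) (col2P w) col2D !iotaG_col2 eltM.
  by congr elt; rewrite ?mod0z; ring.
- move=> v w; rewrite (col2P v) (col2P w) !iotaG_col2 => /elt_inj[].
  by case: delta01 => -> *; congr col2; lia.
- move=> x y; have [a [b [c [s ->]]]] := eltP x.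
  have [a' [b' [c' [s' ->]]]] := eltP y.
  rewrite eltM !projG_elt col2D; congr col2.
  by case: delta01 => ->; ring.
(* The first coordinate of [projG] takes the value 1 at [e1] if [delta = 0] and at [e3] if
   [delta = 1]. *)
- move=> a; rewrite (col2P a);
  exists (elt (a 0 0 * (1 - delta)) 0 (a 0 0 * delta) (a 1 0)).
  by rewrite projG_elt; case: delta01 => ->; congr col2; ring.
- move=> x; have [a [b [c [s ->]]]] := eltP x; rewrite projG_elt.
  split=> [|[w]]; last first.
    rewrite (col2P w) iotaG_col2 => /elt_inj[-> _ -> ->].
    by rewrite (col2P 0) !mxE; congr col2; case: delta01 => ->; ring.
  rewrite (col2P 0) !mxE => /col2_inj[e ->].
  exists (col2 b (delta * a + (1 - delta) * c)); rewrite iotaG_col2.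
  by congr elt; move: e; case: delta01 => -> ; lia.
- move=> a b; rewrite (col2P a) (col2P b) col2D !chiG_col2.
  by rewrite -modzDm; case: (parity (a 1 0)%R) => ->; case: (parity (b 1 0)%R) => ->.
- by move=> a; rewrite /chiG; case: (parity (a 1 0)%R) => ->; [left | right].
- by exists (col2 0 1); rewrite chiG_col2.
- move=> x w; have [a [b [c [s ->]]]] := eltP x; rewrite (col2P w).
  rewrite projG_elt chiG_col2 col2Z !iotaG_col2 !eltM.
  by congr elt; rewrite ?mod0z; case: (parity s) => e; rewrite ?e;
    case: delta01 => e'; rewrite ?e'; ring.
Qed.

End ADelta.

(** * Parity constraints on automorphisms *)

Lemma det_mx22 (N : 'M[int]_2) : \det N = N 0 0 * N 1 1 - N 0 1 * N 1 0.
Proof.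
rewrite (expand_det_row _ 0) !big_ord_recl big_ord0 /cofactor !det_mx11 !mxE /=.
rewrite expr0 expr1 mul1r addr0 mulN1r mulrN.
by congr (_ * N _ _ - N _ _ * N _ _); apply: val_inj.
Qed.

Lemma det_1B_mx22 (N : 'M[int]_2) : \det (1%:M - N) = 1 - (N 0 0 + N 1 1) + \det N.
Proof. by rewrite !det_mx22 !mxE /= ; ring. Qed.

Lemma det_1D_mx22 (N : 'M[int]_2) : \det (1%:M + N) = 1 + (N 0 0 + N 1 1) + \det N.
Proof. by rewrite !det_mx22 !mxE /= ; ring. Qed.

(** Modulo 2 the product of the diagonal entries equals the determinant, which is odd, so both
    entries are odd. *)
Lemma trace_mx22_even (N : 'M[int]_2) (c : int) : N \in unitmx ->
  N 0 1 * N 1 0 = 2 * c -> exists t, N 0 0 + N 1 1 = 2 * t.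
Proof.
move=> /absz_det_unitmx; rewrite det_mx22 => + e; rewrite e.
move: (N 0 0) (N 1 1) => a d dN; exists ((a + d) %/ 2)%Z.
have [a1 | a1] := parity a; have := divz_eq a 2; rewrite a1;
  move: (a %/ 2)%Z => q aE;
  have [d1 | d1] := parity d; have := divz_eq d 2; rewrite d1;
  move: (d %/ 2)%Z => r dE; subst a d; nia.
Qed.

Lemma det_unitmx_sign n (N : 'M[int]_n) : N \in unitmx -> \det N = 1 \/ \det N = -1.
Proof. by rewrite unitmxE => /orP[]/eqP ->; [left | right]. Qed.

Lemma action_lower_even (M : 'M[int]_2) :
  (forall a, chiG (M *m a) = chiG a) -> exists c, M 1 0 = 2 * c.
Proof.
move=> chiM; exists ((M 1 0)%R %/ 2)%Z; have := chiM (col2 1 0).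
by rewrite mulmx_col2 !chiG_col2; have := divz_eq (M 1 0)%R 2; lia.
Qed.

(** The two terms differ by [2 t], so they have the same parity. *)
Lemma absz_sum_even (t D : int) : D = 1 \/ D = -1 ->
  exists e, (`|(1 - t + D)%R| + `|(1 + t + D)%R| = 2 * e)%N.
Proof. by move=> D1; exists ((`|(1 - t + D)%R| + `|(1 + t + D)%R|) %/ 2)%N; lia. Qed.


Section Automorphisms.
Variable delta : int.
Notation G := (semidirect (A_delta_unit delta)).
Variables (phi : {multiplicative G -> G}) (psi M : 'M[int]_2).
Hypotheses (psiE : forall w, phi (iotaG delta w) = iotaG delta (psi *m w))
  (ME : forall x, projG (phi x) = M *m projG x)
  (chiM : forall a, chiG (M *m a) = chiG a).

(* Apply [phi] to [t u = w2 u t], where [u = e3] and [w2 = e1 - 2 e3]. *)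
Lemma kernel_upper_even : delta = 1 -> exists c, psi 0 1 = 2 * c.
Proof.
move=> d1; pose t : G := elt delta 0 0 0 1; pose u : G := elt delta 0 0 1 0.
have tu : (t * u = iotaG delta (col2 0 1) * u * t)%g.
  by rewrite iotaG_col2 !eltM; congr elt; rewrite d1.
have := congr1 phi tu; have pu := ME u; have pt := ME t.
rewrite !gmulfM psiE.
have [a [b [c [s uE]]]] := eltP (phi u); have [a' [b' [c' [s' tE]]]] := eltP (phi t).
(* [u] has sign 1 and [t] has sign -1; invariance of [chiG] under [M] gives the exponents of their
   images the same parities. *)
have sE : (s %% 2)%Z = 0.
  have := chiM (projG u); rewrite -pu uE !projG_elt !chiG_col2; lia.
have s'E : (s' %% 2)%Z = 1.
  have := chiM (projG t); rewrite -pt tE !projG_elt !chiG_col2; lia.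
(* The [e2]-coordinates of the two sides give [b' - b = psi 0 1 + b + b']. *)
rewrite uE tE mulmx_col2 iotaG_col2 !eltM add0r mod0z sE s'E => /elt_inj[_ e _ _].
by exists (- b); move: e; lia.
Qed.

End Automorphisms.

Section Spectrum.
Variable delta : int.
Hypothesis delta01 : delta = 0 \/ delta = 1.
Notation G := (semidirect (A_delta_unit delta)).

Lemma reidemeister_number_automorphism (phi : {multiplicative G -> G}) :
  bijective phi ->
  (delta = 0 -> multiples_infty 2 (reidemeister_number phi)) /\
  (delta = 1 -> multiples_infty 4 (reidemeister_number phi)).
Proof.
move=> phi_bij; have ext := sign_extensionG delta01.
have [psi [M [psiE ME]]] := endo_matrices ext phi.
have [psiU MU] := endo_matrices_unitmx ext phi_bij psiE ME.
have dpsi : \det psi != 0 by have := absz_det_unitmx psiU; lia.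
have chiM := chi_endo ext psiE ME isT dpsi.
have sing := reidemeister_number_extension_singular ext psiE ME.
have None_ok : reidemeister_number phi = None ->
    (delta = 0 -> multiples_infty 2 (reidemeister_number phi)) /\
    (delta = 1 -> multiples_infty 4 (reidemeister_number phi)).
  by move=> ->; split=> _; right.
have [d0 | dM] := eqVneq (\det (1%:M - M)) 0; first by apply/None_ok/sing; left.
have [d0 | d1] := eqVneq (\det (1%:M - psi)) 0.
  by apply/None_ok/sing; right; left.
have [d0 | d2] := eqVneq (\det (1%:M + psi)) 0.
  by apply/None_ok/sing; right; right.
have [k -> kE] := reidemeister_number_extension ext psiE ME chiM dM d1 d2.
have [c cE] := action_lower_even chiM.
have [|tM tME] := @trace_mx22_even M (M 0 1 * c) MU; first by rewrite cE; ring.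
have DM := det_unitmx_sign MU; have Dpsi := det_unitmx_sign psiU.
move: kE dM d1 d2; rewrite !det_1B_mx22 det_1D_mx22 tME.
set D := \det psi in Dpsi *; set m := (X in X != 0) => kE m0 d1 d2.
(* [m = 1 - 2 tM + det M] with [det M] odd; its factor 2 cancels the one in [2 * k]. *)
have [m' mE] : exists m' : nat, `|m|%N = (2 * m')%N.
  by exists (`|m| %/ 2)%N; rewrite /m; move: DM; lia.
have {}kE : k = (m' * (`|(1 - (psi 0 0 + psi 1 1) + D)%R| +
    `|(1 + (psi 0 0 + psi 1 1) + D)%R|))%N by rewrite mE in kE; lia.
have m'0 : (0 < m')%N by lia.
split=> dE; left.
  have [e eE] := absz_sum_even (psi 0 0 + psi 1 1) Dpsi.
  exists (m' * e)%N; last by rewrite kE eE; congr Some; lia.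
  by rewrite /= muln_gt0 m'0; lia.
have [b bE] := kernel_upper_even psiE ME chiM dE.
have [|t tE] := @trace_mx22_even psi (b * psi 1 0) psiU; first by rewrite bE; ring.
move: d1 d2 kE; rewrite tE => d1 d2 kE.
(* Since [D] is odd both terms are even, and their halves differ by [2 t], so the sum of absolute
   values is divisible by 4. *)
have [e eE] : exists e, (`|(1 - 2 * t + D)%R| + `|(1 + 2 * t + D)%R| = 4 * e)%N.
  by exists ((`|(1 - 2 * t + D)%R| + `|(1 + 2 * t + D)%R|) %/ 4)%N; lia.
exists (m' * e)%N; last by rewrite kE eE; congr Some; lia.
by rewrite /= muln_gt0 m'0; lia.
Qed.

End Spectrum.

(** * Automorphisms realizing every value *)

Section Realization.
Variable delta : int.
Hypothesis delta01 : delta = 0 \/ delta = 1.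
Notation G := (semidirect (A_delta_unit delta)).

(* Fixes [t], and acts on [Z^3] by the matrix [[1, l1, l2], [0, a, b], [0, c, d]]. *)
Definition lin_auto (l1 l2 a b c d : int) (x : G) : G :=
  elt delta (x.1 0 0 + l1 * x.1 1 0 + l2 * x.1 2%:R 0)
    (a * x.1 1 0 + b * x.1 2%:R 0) (c * x.1 1 0 + d * x.1 2%:R 0) x.2.

(* For [e = 1], fixes [Z^3] and maps [t] to [y t], where [y = e1] if [delta = 0]
   and [y = e3] if [delta = 1]. *)
Definition shear_auto (e : int) (x : G) : G :=
  elt delta (x.1 0 0 + e * ((1 - delta) * x.2 + delta * (x.2 %/ 2)%Z)) (x.1 1 0)
    (x.1 2%:R 0 + e * (delta * (x.2 %% 2)%Z)) x.2.

(* [t ^ 2] is central. *)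
Definition central_auto (e : int) (x : G) : G :=
  elt delta (x.1 0 0) (x.1 1 0) (x.1 2%:R 0) (x.2 + 2 * (e * projG x 0 0)).

Lemma lin_auto_elt l1 l2 a b c d x y z s :
  lin_auto l1 l2 a b c d (elt delta x y z s) =
  elt delta (x + l1 * y + l2 * z) (a * y + b * z) (c * y + d * z) s.
Proof. by rewrite /lin_auto !mxE. Qed.

Lemma shear_auto_elt e x y z s :
  shear_auto e (elt delta x y z s) =
  elt delta (x + e * ((1 - delta) * s + delta * (s %/ 2)%Z)) y
    (z + e * (delta * (s %% 2)%Z)) s.
Proof. by rewrite /shear_auto !mxE. Qed.

Lemma central_auto_elt e x y z s :
  central_auto e (elt delta x y z s) =
  elt delta x y z (s + 2 * (e * ((1 + delta) * x + delta * z))).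
Proof. by rewrite /central_auto projG_elt !mxE. Qed.

(** The two equations say that the matrix commutes with [A]. *)
Lemma lin_autoM l1 l2 a b c d :
    2 * l1 = - delta * c -> 2 * l2 = delta * (1 - d) ->
  {morph lin_auto l1 l2 a b c d : x y / (x * y)%g}.
Proof.
move=> l1E l2E x y; have [x1 [x2 [x3 [s ->]]]] := eltP x.
have [y1 [y2 [y3 [r ->]]]] := eltP y; rewrite eltM !lin_auto_elt eltM.
have [e | e] := parity s; rewrite e; congr elt; try ring.
have -> : delta * 1 * (c * y2 + d * y3) = delta * y3 - 2 * l1 * y2 - 2 * l2 * y3.
  by rewrite l1E l2E; ring.
ring.
Qed.

(** The formula computes [(y t)^s]: if [delta = 1], then [e3 + A e3 = e1], so each pair of factors
    contributes [e1] and an odd remaining one contributes [e3]. *)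
Lemma shear_autoM : {morph shear_auto 1 : x y / (x * y)%g}.
Proof.
move=> x y; have [x1 [x2 [x3 [s ->]]]] := eltP x.
have [y1 [y2 [y3 [r ->]]]] := eltP y; rewrite eltM !shear_auto_elt eltM.
have [e | e] := parity s; rewrite e; congr elt; try ring;
  by case: delta01 => e'; rewrite e'; lia.
Qed.

Lemma central_autoM e : {morph central_auto e : x y / (x * y)%g}.
Proof.
move=> x y; have [x1 [x2 [x3 [s ->]]]] := eltP x.
have [y1 [y2 [y3 [r ->]]]] := eltP y; rewrite eltM !central_auto_elt eltM.
have par u : ((s + 2 * u) %% 2)%Z = (s %% 2)%Z by lia.
rewrite par; congr elt.
by have [f | f] := parity s; rewrite f; case: delta01 => e'; rewrite e'; ring.
Qed.

Lemma shear_auto_bij : bijective (shear_auto 1).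
Proof.
by exists (shear_auto (-1)) => x; have [x1 [x2 [x3 [s ->]]]] := eltP x;
  rewrite !shear_auto_elt; congr elt; ring.
Qed.

Lemma central_auto_bij e : bijective (central_auto e).
Proof.
by exists (central_auto (- e)) => x; have [x1 [x2 [x3 [s ->]]]] := eltP x;
  rewrite !central_auto_elt; congr elt; ring.
Qed.

(* For this choice the restriction to the image of [iotaG] has determinant [-1]
   and trace [(1 + delta) k]. *)
Definition lin_auto_k (k : int) : G -> G :=
  lin_auto (delta * k) (delta * (1 - k)) delta (1 - 2 * delta)
    ((1 - delta) - 2 * delta * k) ((1 + delta) * k - delta).

Lemma lin_auto_kM k : {morph lin_auto_k k : x y / (x * y)%g}.
Proof. by apply: lin_autoM; case: delta01 => e; rewrite e; ring. Qed.

Lemma lin_auto_k_bij k : bijective (lin_auto_k k).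
Proof.
(* The lower right 2 by 2 block has determinant -1; these are the entries of the inverse matrix. *)
exists (lin_auto (delta * k) delta (delta - (1 + delta) * k) (1 - 2 * delta)
    ((1 - delta) - 2 * delta * k) (- delta)) => x;
  have [x1 [x2 [x3 [s ->]]]] := eltP x; rewrite /lin_auto_k !lin_auto_elt;
  by congr elt; case: delta01 => e; rewrite e; ring.
Qed.

Lemma reidemeister_number_realized (k : nat) : (0 < k)%N ->
  exists2 phi : {multiplicative G -> G}, bijective phi &
    reidemeister_number phi = Some (2 * (`|(1 + delta)%R| * k))%N.
Proof.
move=> k0; pose f := central_auto 1 \o shear_auto 1 \o lin_auto_k k%:Z.
have fM : {morph f : x y / (x * y)%g}.
  by move=> x y; rewrite /f /= lin_auto_kM shear_autoM central_autoM.
have f_bij : bijective f.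
  exact: bij_comp (bij_comp (central_auto_bij 1) shear_auto_bij) (lin_auto_k_bij k).
pose phi : {multiplicative G -> G} := HB.pack f (isMultiplicative.Build G G f fM).
exists phi => //.
pose psi := mx22 delta (1 + delta) (1 - delta + delta * k%:Z)
  ((1 + delta) * k%:Z - delta).
(* The linear factor is trivial on the quotient; [M] is the product of [[[1, 0], [2, 1]]] from the
   central factor and [[[1, 1], [0, 1]]] from the shear. *)
pose M := mx22 1 1 2 3.
have ext := sign_extensionG delta01.
have psiE w : phi (iotaG delta w) = iotaG delta (psi *m w).
  rewrite (col2P w) mulmx_col2 !mxE /= !iotaG_col2 /f /=.
  rewrite /lin_auto_k lin_auto_elt shear_auto_elt central_auto_elt div0z mod0z.
  by congr elt; case: delta01 => e; rewrite e; ring.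
have ME x : projG (phi x) = M *m projG x.
  have [x1 [x2 [x3 [s ->]]]] := eltP x.
  rewrite /= /f /= /lin_auto_k lin_auto_elt shear_auto_elt central_auto_elt !projG_elt.
  rewrite mulmx_col2 !mxE /=.
  by congr col2; case: delta01 => e; rewrite e; lia.
have chiM a : chiG (M *m a) = chiG a.
  by rewrite (col2P a) mulmx_col2 !chiG_col2 !mxE /=; lia.
have kz : k%:Z != 0 by lia.
have dM : \det (1%:M - M) = -2.
  by rewrite det_1B_mx22 det_mx22 !mxE.
have d1 : \det (1%:M - psi) = - ((1 + delta) * k%:Z).
  by rewrite det_1B_mx22 det_mx22 !mxE /=; case: delta01 => e; rewrite e; ring.
have d2 : \det (1%:M + psi) = (1 + delta) * k%:Z.
  by rewrite det_1D_mx22 det_mx22 !mxE /=; case: delta01 => e; rewrite e; ring.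
have [||| R RE] := reidemeister_number_extension ext psiE ME chiM.
- by rewrite dM.
- by rewrite d1; case: delta01 => e; rewrite e; lia.
- by rewrite d2; case: delta01 => e; rewrite e; lia.
rewrite RE dM d1 d2 abszN abszM => e; congr Some.
by move: e; case: delta01 => e; rewrite e; lia.
Qed.

(** Supplies the value infinity: here [1 - M] is zero. *)
Lemma reidemeister_number_idfun :
  reidemeister_number (idfun : {multiplicative G -> G}) = None.
Proof.
apply: (reidemeister_number_extension_singular (sign_extensionG delta01)
  (psi := 1%:M) (M := 1%:M)) => [w | x |]; rewrite ?mul1mx //.
by left; rewrite subrr det0.
Qed.

Lemma reidemeister_spectrum_A_delta (m : nat) :
    m = (2 * `|(1 + delta)%R|)%N ->
    (forall phi : {multiplicative G -> G}, bijective phi ->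
      multiples_infty m (reidemeister_number phi)) ->
  reidemeister_spectrum G = multiples_infty m.
Proof.
move=> mE sub; apply/seteqP; split=> [_ [phi phi_bij <-] | _ [[k k0 <-] | ->]].
- exact: sub.
- have [phi phi_bij phiE] := reidemeister_number_realized k0.
  by exists phi; rewrite // phiE mE mulnA.
- by exists idfun; [exists idfun | exact: reidemeister_number_idfun].
Qed.

End Realization.

Theorem proposition5p10 (delta : int)
    (delta01 : delta = 0%R \/ delta = 1%R) :
  (delta = 0%R ->
     reidemeister_spectrum (semidirect (A_delta_unit delta))
       = multiples_infty 2) /\
  (delta = 1%R ->
     reidemeister_spectrum (semidirect (A_delta_unit delta))
       = multiples_infty 4).
Proof.
split=> dE; apply: (reidemeister_spectrum_A_delta delta01) => [|phi phi_bij].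
- by rewrite dE.
- exact: (reidemeister_number_automorphism delta01 phi_bij).1.
- by rewrite dE.
- exact: (reidemeister_number_automorphism delta01 phi_bij).2.
Qed.
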